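(* For every integer $k \geq 2$, let $t(k)$ be the largest integer $s$ such that $\frac{1}{s}+\frac{1}{s+1}+\cdots+\frac{1}{k}>1$, and let $\mathcal{F}_k^{\le t(k)}=\{\Delta_{(k-i,i)} : 1\le i\le t(k)\}$. Then the Tur\'an density satisfies $\pi(\mathcal{F}_k^{\le t(k)}) = k!/k^k$.
   Context: A $k$-graph is a $k$-uniform hypergraph. For a family $\mathcal{F}$ of $k$-graphs, the Tur\'an number $\mathrm{ex}(n,\mathcal{F})$ is the maximum number of edges in an $n$-vertex $k$-graph containing no member of $\mathcal{F}$ as a subgraph, and the Tur\'an density is $\pi(\mathcal{F})=\lim_{n\to\infty}\mathrm{ex}(n,\mathcal{F})/\binom{n}{k}$. For $i\in[k]$, the $(k-i,i)$-tent $\Delta_{(k-i,i)}$ is the $k$-graph with vertex set $[2k-1]=\{1,\dots,2k-1\}$ and edge set $\{\{1,2,\ldots,k\},\ \{1,\ldots,i,k+1,\ldots,2k-i\},\ \{i+1,\ldots,k+1,2k-i+1,\ldots,2k-1\}\}$. *)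

(* Defs.v *)
From mathcomp Require Import all_boot all_order all_algebra.
From mathcomp Require Import all_classical all_reals all_analysis.
From mathcomp Require Import zify.

Set Implicit Arguments.
Unset Strict Implicit.
Unset Printing Implicit Defensive.

Import Order.TTheory GRing.Theory Num.Theory.
Import numFieldNormedType.Exports.

(* A finite hypergraph, with its vertices numbered: the vertex set is
   'I_(hg_order G). *)
Record hypergraph := Hypergraph {
  hg_order : nat;
  hg_edges : {set {set 'I_hg_order}}
}.

Definition k_uniform (k : nat) (G : hypergraph) : Prop :=
  forall e, e \in hg_edges G -> #|e| = k.

(* H is isomorphic to a (not necessarily induced) subgraph of G. *)
Definition has_copy (G H : hypergraph) : Prop :=
  exists f : 'I_(hg_order H) -> 'I_(hg_order G),
    injective f /\ forall e, e \in hg_edges H -> (f @: e)%SET \in hg_edges G.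

Definition family_free (F : set hypergraph) (G : hypergraph) : Prop :=
  forall H, F H -> ~ has_copy G H.

Definition turan_number (k n : nat) (F : set hypergraph) : nat :=
  \max_(E : {set {set 'I_n}} |
        `[< k_uniform k (Hypergraph E) /\ family_free F (Hypergraph E) >]) #|E|.

(* The finitely many indices n < k, where 'C(n, k) = 0, are irrelevant to the
   limit. *)
Definition turan_ratio (R : realType) (k : nat) (F : set hypergraph) :
    nat -> R :=
  fun n => ((turan_number k n F)%:R / 'C(n, k)%:R)%R.

Definition turan_density (R : realType) (k : nat) (F : set hypergraph) : R :=
  limn (turan_ratio R k F).

(* The element x of 'I_(2 * k - 1) stands for the vertex x + 1 of
   {1, ..., 2k - 1}. *)
Definition tent_vertices (k : nat) (P : pred nat) : {set 'I_(2 * k - 1)} :=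
  [set x : 'I_(2 * k - 1) | P x.+1]%SET.

Definition tent_edge1 (k : nat) : {set 'I_(2 * k - 1)} :=
  tent_vertices k (fun v => 1 <= v <= k).

Definition tent_edge2 (k i : nat) : {set 'I_(2 * k - 1)} :=
  tent_vertices k (fun v => (1 <= v <= i) || (k + 1 <= v <= 2 * k - i)).

Definition tent_edge3 (k i : nat) : {set 'I_(2 * k - 1)} :=
  tent_vertices k (fun v =>
    (i + 1 <= v <= k + 1) || (2 * k - i + 1 <= v <= 2 * k - 1)).

(* The (k - i, i)-tent. It is k-uniform for 1 <= i < k (tent_uniform), which
   covers all i <= tent_threshold k (tent_thresholdP); for i = k the third edge
   has only k - 1 vertices. *)
Definition tent (k i : nat) : hypergraph :=
  Hypergraph [set tent_edge1 k; tent_edge2 k i; tent_edge3 k i]%SET.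

Definition harmonic_tail (s k : nat) : rat :=
  (\sum_(s <= j < k.+1) j%:R^-1)%R.

(* Restricting to 1 <= s <= k loses nothing: harmonic_tail s k is an empty sum
   for s > k, and 1 / s makes no sense for s = 0. See tent_thresholdP. *)
Definition tent_threshold (k : nat) : nat :=
  \max_(1 <= s < k.+1 | (1 < harmonic_tail s k)%R) s.

Definition tents_up_to (k t : nat) : set hypergraph :=
  [set tent k i | i in [set i | 1 <= i <= t]]%classic.

Lemma tent_thresholdP (k : nat) : 2 <= k ->
  [/\ 1 <= tent_threshold k < k,
      (1 < harmonic_tail (tent_threshold k) k)%R &
      forall s, 1 <= s -> (1 < harmonic_tail s k)%R -> s <= tent_threshold k].
Proof.
move=> k2.
have ub s : 1 <= s -> (1 < harmonic_tail s k)%R -> s <= tent_threshold k.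
  move=> s1 hs; rewrite /tent_threshold.
  have sk : s <= k.
    rewrite leqNgt; apply/negP => ks; move: hs.
    by rewrite /harmonic_tail big_geq.
  apply: (@leq_bigmax_seq _ _ (fun j => 1 < harmonic_tail j k)%R id) => //.
  by rewrite mem_index_iota s1 ltnS.
have h1 : (1 < harmonic_tail 1 k)%R.
  have k1 : 1 < k.+1 by lia.
  have k3 : 2 < k.+1 by lia.
  rewrite /harmonic_tail (big_ltn k1) (big_ltn k3) invr1 ltrDl.
  apply: ltr_wpDr; last by rewrite invr_gt0 ltr0n.
  by apply: sumr_ge0 => j _; rewrite invr_ge0 ler0n.
have t1 := ub 1 isT h1.
have ht : (1 < harmonic_tail (tent_threshold k) k)%R.
  move: t1; rewrite /tent_threshold.
  apply: (big_ind (fun m => 1 <= m -> (1 < harmonic_tail m k)%R)) => //.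
  by move=> x y hx hy; rewrite /maxn; case: ifP.
split => //; rewrite t1 ltnNge; apply/negP => kt; move: ht.
rewrite ltNge => /negP; apply; move: kt; rewrite leq_eqVlt => /orP[/eqP <-|kt].
  rewrite /harmonic_tail big_nat1 invf_le1 ?ltr0n ?ler1n; lia.
by rewrite /harmonic_tail big_geq.
Qed.

Lemma card_tent_vertices (k : nat) (P : pred nat) :
  #|tent_vertices k P| = \sum_(1 <= v < 2 * k | P v) 1.
Proof.
rewrite -sum1_card big_add1 -[in RHS]subn1 big_mkord.
by apply: eq_bigl => x; rewrite inE.
Qed.

Lemma tent_uniform (k i : nat) : 1 <= i < k -> k_uniform k (tent k i).
Proof.
move=> /andP[i1 ik].
have cnt a b n (P : pred nat) : a <= b -> b <= n ->
    (forall v, 1 <= v < n -> P v = (a <= v < b)) -> 0 < a ->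
    \sum_(1 <= v < n | P v) 1 = b - a.
  move=> ab bn hP a0.
  have an : a <= n by lia.
  rewrite (big_cat_nat a0 an) (big_cat_nat ab bn) /=.
  have -> : \sum_(1 <= v < a | P v) 1 = 0.
    by rewrite big_nat_cond big_pred0 // => v; case: andP => // -[h]; rewrite hP; lia.
  have -> : \sum_(b <= v < n | P v) 1 = 0.
    by rewrite big_nat_cond big_pred0 // => v; case: andP => // -[h]; rewrite hP; lia.
  rewrite add0n addn0 -[RHS]muln1 -sum_nat_const_nat big_nat_cond [RHS]big_nat_cond.
  apply: eq_bigl => v; case: (boolP (a <= v < b)) => //= h; rewrite hP; lia.
have dj n (P Q : pred nat) : (forall v, 1 <= v < n -> ~~ (P v && Q v)) ->
   \sum_(1 <= v < n | P v || Q v) 1 =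
   \sum_(1 <= v < n | P v) 1 + \sum_(1 <= v < n | Q v) 1.
  move=> h; rewrite big_mkcond [X in _ = X + _]big_mkcond
    [X in _ = _ + X]big_mkcond -big_split /= big_nat [RHS]big_nat.
  by apply: eq_bigr => v /h; case: (P v); case: (Q v).
move=> e; rewrite !inE => /orP[/orP[]|] /eqP ->; rewrite card_tent_vertices.
- by rewrite (cnt 1 k.+1) //; lia.
- rewrite dj; last by move=> v; lia.
  by rewrite (cnt 1 i.+1) ?(cnt (k + 1) (2 * k - i).+1) //; lia.
- rewrite dj; last by move=> v; lia.
  by rewrite (cnt (i + 1) (k + 2)) ?(cnt (2 * k - i + 1) (2 * k)) //; lia.
Qed.

(* Main.v *)
Require Import Defs.
From mathcomp Require Import all_boot all_order all_fingroup all_algebra.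
From mathcomp Require Import all_classical all_reals all_analysis.
From mathcomp Require Import zify ring lra.

Set Implicit Arguments.
Unset Strict Implicit.
Unset Printing Implicit Defensive.

Import Order.TTheory GRing.Theory Num.Theory.
Import numFieldNormedType.Exports.

(** Lower bound: complete k-partite k-graphs contain no tent.

    Upper bound, following Chao and Yu's entropy method.  Deleting O(n^(k-1))
    edges makes every nonempty codegree exceed k; then a homomorphic image of a
    tent can be completed to an actual tent, so images are excluded as well.
    For a uniformly random ordered edge (X_1, ..., X_k) let y_i be the
    exponential of the entropy of a vertex conditioned on k - i others.  Then
    y_1 ... y_k = k! |E| and y_k <= n.  Excluding images of the (k - i, i)-tent
    makes two conditional neighbourhoods disjoint, and the inequality between
    geometric and arithmetic means turns this into y_i + y_j <= y_(i+j) for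
    every j with i + j <= k.

    Since these inequalities hold for all i <= t and 1/(t+1) + ... + 1/k <= 1,
    they imply y_1/1 + y_2/2 + ... + y_k/k <= y_k, which is classical when y is
    superadditive.  For k >= 2t + 2 it is obtained from the superadditive
    function D(r) = min_j (y_(j+r) - y_j), which agrees with y up to t and
    bounds y_(k-r) <= y_k - D(r).  The AM-GM inequality then gives
    y_1 ... y_k <= k! (y_k / k)^k, that is |E| <= (n / k)^k. *)

(** * Superadditive sequences *)

Section Superadditive.
Local Open Scope ring_scope.
Variable R : realFieldType.
Implicit Types (D x a : nat -> R) (k m n t : nat).

Definition weighted_sum D m : R := \sum_(1 <= i < m.+1) D i / i%:R.

Lemma weighted_sum0 D : weighted_sum D 0 = 0.
Proof. by rewrite /weighted_sum big_geq. Qed.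

Lemma weighted_sumS D m :
  weighted_sum D m.+1 = weighted_sum D m + D m.+1 / m.+1%:R.
Proof. by rewrite /weighted_sum big_nat_recr. Qed.

(** Each [D i / i] occurs in [m + 1 - i] of the partial sums. *)
Lemma sum_weighted_sum D m :
  \sum_(1 <= j < m.+1) weighted_sum D j =
  m.+1%:R * weighted_sum D m - \sum_(1 <= i < m.+1) D i.
Proof.
elim: m => [|m IH]; first by rewrite !big_geq // weighted_sum0 mulr0 subr0.
rewrite big_nat_recr // IH [in RHS]big_nat_recr //= weighted_sumS.
have : m.+1%:R != 0 :> R by rewrite pnatr_eq0.
rewrite -[m.+2%:R]natr1; move: (m.+1%:R : R) => c h; by field.
Qed.

Definition superadditive_upto D k :=
  forall i j, (0 < i)%N -> (0 < j)%N -> (i + j <= k)%N -> D i + D j <= D (i + j)%N.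

(** Pair [i] with [m + 1 - i]. *)
Lemma superadditive_sum D k m : superadditive_upto D k -> (m < k)%N ->
  (\sum_(1 <= i < m.+1) D i) * 2 <= m%:R * D m.+1.
Proof.
move=> sD mk; rewrite mulr_natr mulr2n.
rewrite [X in _ + X]big_nat_rev -big_split /=.
have -> : m%:R * D m.+1 = \sum_(1 <= i < m.+1) D m.+1.
  by rewrite sumr_const_nat subSS subn0 mulr_natl.
rewrite big_nat_cond [leRHS]big_nat_cond; apply: ler_sum => i; rewrite andbT => /andP[i1 im].
apply: le_trans (sD _ _ _ _ _) _ => //; try lia.
by have -> : (i + (1 + m.+1 - i.+1) = m.+1)%N by lia.
Qed.

(** Strong induction: adding the bounds for all [j <= m] shows that [(m + 1) * weighted_sum D m] is
    at most twice the sum of the [D i], hence at most [m * D m.+1]. *)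
Lemma weighted_sum_le D k m : superadditive_upto D k -> (0 < m <= k)%N ->
  weighted_sum D m <= D m.
Proof.
move=> sD; elim/ltn_ind: m => -[//|m] IH /andP[_ mk].
rewrite weighted_sumS.
have h1 := superadditive_sum sD mk.
have h2 : \sum_(1 <= j < m.+1) weighted_sum D j <= \sum_(1 <= i < m.+1) D i.
  rewrite big_nat_cond [leRHS]big_nat_cond; apply: ler_sum => i; rewrite andbT => /andP[i1 im].
  by apply: IH => //; lia.
rewrite sum_weighted_sum in h2.
have p : 0 < m.+1%:R :> R by rewrite ltr0n.
rewrite -(ler_pM2l p) mulrDr mulrCA divff ?gt_eqF// mulr1.
rewrite -natr1 in h2 *; lra.
Qed.

(** These are running means of [D i / i]. By [weighted_sum_le] each new entry is at least the new
    mean, so the means do not decrease. *)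
Lemma weighted_mean_homo D k m n : superadditive_upto D k ->
  (0 < m <= n)%N -> (n <= k)%N ->
  weighted_sum D m / m%:R <= weighted_sum D n / n%:R.
Proof.
move=> sD /andP[m0]; elim: n => [|n IH]; first by rewrite leqn0 => /eqP ->.
rewrite leq_eqVlt => /orP[/eqP -> //|mn] nk.
apply: le_trans (IH _ _) _; try lia.
have := @weighted_sum_le D k n.+1 sD; rewrite nk => /(_ isT); rewrite weighted_sumS => h.
have n0 : 0 < n%:R :> R by rewrite ltr0n; lia.
have n1 : 0 < n.+1%:R :> R by rewrite ltr0n.
rewrite ler_pdivrMr // mulrAC ler_pdivlMr // -natr1.
rewrite -natr1 in h n1.
have e : D n.+1 / (n%:R + 1) * (n%:R + 1) = D n.+1 by rewrite divfK ?gt_eqF.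
nra.
Qed.

(* Chebyshev's sum inequality needs [D r / r] nondecreasing; here only its
   running averages are. *)
Lemma chebyshev_weighted_mean D k a N : superadditive_upto D k -> (0 < N <= k)%N ->
  (forall r, (0 < r < N)%N -> a r <= a r.+1) ->
  weighted_sum D N / N%:R * \sum_(1 <= r < N.+1) a r <=
  \sum_(1 <= r < N.+1) a r * (D r / r%:R).
Proof.
move=> sD; elim: N => [//|[_ _ _|N IH /andP[_ Nk] am]].
  by rewrite !big_nat1 weighted_sumS weighted_sum0 add0r divr1 mulrC.
rewrite [X in X <= _]mulrC big_nat_recr // [leRHS]big_nat_recr //=.
have {}IH := IH (ltnW Nk) (fun r hr => am r ltac:(lia)).
have mon := @weighted_mean_homo D k N.+1 N.+2 sD ltac:(lia) Nk.
have aN : \sum_(1 <= r < N.+2) a r <= N.+1%:R * a N.+2.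
  have -> : N.+1%:R * a N.+2 = \sum_(1 <= r < N.+2) a N.+2.
    by rewrite sumr_const_nat subSS subn0 mulr_natl.
  rewrite big_nat_cond [leRHS]big_nat_cond; apply: ler_sum => i; rewrite andbT => /andP[i1 iN].
  have {i1}: forall j, (i <= j)%N -> (j <= N.+2)%N -> a i <= a j.
    elim=> [|j IHj]; first by rewrite leqn0 => /eqP->.
    rewrite leq_eqVlt => /orP[/eqP -> //|ij] jN.
    by apply: le_trans (IHj _ _) (am _ _); lia.
  by apply; lia.
(* Written through two consecutive means [s] and [s'], the last term reduces the induction step to
   [0 <= (s' - s) * (n * a N.+2 - A)]. *)
have d : D N.+2 / N.+2%:R =
    N.+2%:R * (weighted_sum D N.+2 / N.+2%:R) - N.+1%:R * (weighted_sum D N.+1 / N.+1%:R).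
  by rewrite !(mulrCA _ (weighted_sum _ _)) !divff ?pnatr_eq0 // !mulr1 weighted_sumS [RHS]addrC addKr.
rewrite d; move: mon IH aN; rewrite -[N.+2%:R]natr1.
set s := weighted_sum D N.+1 / _; set s' := weighted_sum D N.+2 / _.
set A := \sum_(_ <= _ < _) a _; set B := \sum_(_ <= _ < _) _; set n := N.+1%:R => mon IH aN.
have := mulr_ge0 (_ : 0 <= s' - s) (_ : 0 <= n * a N.+2 - A).
rewrite !subr_ge0 => /(_ mon aN); lra.
Qed.

Lemma sum_split_rev (F : nat -> R) k N : (N < k)%N ->
  \sum_(1 <= j < k) F j = \sum_(1 <= j < k - N) F j + \sum_(1 <= r < N.+1) F (k - r)%N.
Proof.
elim: N => [|N IH] Nk; first by rewrite subn0 [X in _ + X]big_geq // addr0.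
rewrite (IH (ltnW Nk)) [X in _ = _ + X]big_nat_recr //= [X in _ = _ + X]addrC addrA; congr (_ + _).
have -> : (k - N = (k - N.+1).+1)%N by lia.
by rewrite big_nat_recr //; lia.
Qed.

(** The least growth of [x] over a window of length [r] in [[0, k]]. The default [x k] is harmless:
    for [r <= k] and nonnegative [x], the window ending at [k] already grows by at most [x k]. *)
Definition increment_min x k r : R :=
  \big[Num.min/x k]_(j < (k - r).+1) (x (j + r)%N - x j).

Lemma increment_min_le x k r j : (j + r <= k)%N ->
  increment_min x k r <= x (j + r)%N - x j.
Proof.
move=> h; have hj : (j < (k - r).+1)%N by lia.
exact: (@bigmin_le _ _ _ _ (Ordinal hj)).
Qed.

(** A window of length [i + j] splits into windows of lengths [i] and [j]; for the default value,
    the window ending at [k] is split. *)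
Lemma increment_min_superadditive x k : x 0 = 0 -> (forall i, 0 <= x i) ->
  superadditive_upto (increment_min x k) k.
Proof.
move=> x0 xge i j i0 j0 ijk; apply: le_bigmin => [|[l /= hl] _].
  have := increment_min_le x (_ : (k - j + j <= k)%N).
  have := increment_min_le x (_ : (k - i - j + i <= k)%N).
  have -> : (k - i - j + i = k - j)%N by lia.
  rewrite subnK; last by lia.
  move=> /(_ (leq_subr _ _)) h1 /(_ (leqnn _)) h2; have := xge (k - i - j)%N; lra.
have h1 : increment_min x k i <= _ := increment_min_le x (_ : (l + i <= k)%N).
have h2 : increment_min x k j <= _ := increment_min_le x (_ : (l + i + j <= k)%N).
have {}h1 := h1 ltac:(lia); have {}h2 := h2 ltac:(lia).
rewrite addnA; lra.
Qed.

(** The hypothesis puts [x r] below the growth over every window of length [r], and the window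
    starting at [0] attains it. *)
Lemma increment_min_small x k t r : x 0 = 0 ->
  (forall i j, (0 < i <= t)%N -> (0 < j)%N -> (i + j <= k)%N -> x i + x j <= x (i + j)%N) ->
  (forall i, 0 <= x i) -> (0 < r <= t)%N -> (r <= k)%N -> increment_min x k r = x r.
Proof.
move=> x0 sx xge rt rk; apply/eqP; rewrite eq_le; apply/andP; split.
  by have := @increment_min_le x k r 0 rk; rewrite x0 subr0.
have h j : (j + r <= k)%N -> x r <= x (j + r)%N - x j.
  case: j => [|j] hj; first by rewrite x0 subr0.
  by rewrite lerBrDr [(j.+1 + r)%N]addnC; apply: sx => //; lia.
apply: le_bigmin => [|[l /= hl] _]; last by apply: h; lia.
have := h (k - r)%N; rewrite subnK // leqnn => /(_ isT) /le_trans; apply.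
by rewrite gerBl.
Qed.

(** In the main case the terms up to [t] add up to [t * s], with [s] the mean of [D r / r] for
    [r <= t]; the later ones are bounded by [x (k - r) <= x k - D r]. With [H = 1/(t+1) + ... + 1/k]
    the total is at most [k * s * (1 - H) + x k * H], hence at most [x k], since [k * s <= x k] and
    [H <= 1]. *)
Lemma weighted_sum_le_partial x k t : x 0 = 0 -> (forall i, 0 <= x i) ->
  (forall i j, (0 < i <= t)%N -> (0 < j)%N -> (i + j <= k)%N -> x i + x j <= x (i + j)%N) ->
  (0 < t < k)%N -> \sum_(t.+1 <= j < k.+1) (j%:R)^-1 <= 1 :> R ->
  weighted_sum x k <= x k.
Proof.
move=> x0 xge sx /andP[t0 tk] ht.
case: (leqP k (2 * t).+1) => [small|big].
  (* Two indices with sum at most [2t + 1] cannot both exceed [t], so [x] is superadditive up to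
     [k]. *)
  apply: (@weighted_sum_le x k) => [i j i0 j0 ij|]; last by lia.
  case: (leqP i t) => it; first by apply: sx => //; lia.
  by rewrite addrC addnC; apply: sx => //; lia.
pose D := increment_min x k; pose N := (k - t).-1.
have sD : superadditive_upto D k by exact: increment_min_superadditive.
have Nk : (N < k)%N by rewrite /N; lia.
have kN : (k - N = t.+1)%N by rewrite /N; lia.
have k0 : k%:R != 0 :> R by rewrite pnatr_eq0; lia.
pose s := weighted_sum D t / t%:R.
have St : weighted_sum x t = weighted_sum D t.
  rewrite /weighted_sum big_nat_cond [RHS]big_nat_cond; apply: eq_bigr => i; rewrite andbT => /andP[i1 it].
  by rewrite /D (@increment_min_small x k t) //; lia.
have s0 : 0 <= s.
  rewrite /s -St mulr_ge0 ?invr_ge0 ?ler0n //; apply: sumr_ge0 => i _.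
  by rewrite mulr_ge0 ?invr_ge0 ?ler0n.
have Sts : weighted_sum x t = t%:R * s.
  by rewrite St /s mulrCA divff ?mulr1 // pnatr_eq0; lia.
(* These increasing weights turn [D r / (k - r)] into [a r * (D r / r)], as the Chebyshev-type
   inequality requires. *)
pose a r : R := r%:R / (k - r)%:R.
pose A := \sum_(1 <= r < N.+1) a r.
have A0 : 0 <= A by apply: sumr_ge0 => i _; rewrite mulr_ge0 ?invr_ge0 ?ler0n.
pose h := \sum_(1 <= r < N.+1) ((k - r)%:R)^-1 : R.
have hh : \sum_(t.+1 <= j < k.+1) (j%:R)^-1 = h + k%:R^-1 :> R.
  have e1 := @sum_split_rev (fun j => (j%:R)^-1) k N Nk.
  rewrite kN (big_cat_nat (ltn0Sn t) tk) /= in e1.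
  by move/addrI: e1 => e1; rewrite big_nat_recr //= e1.
have AE : A = k%:R * h - N%:R.
  rewrite /A /h mulr_sumr.
  have -> : N%:R = \sum_(1 <= r < N.+1) 1 :> R by rewrite sumr_const_nat subSS subn0.
  rewrite -sumrB big_nat_cond [RHS]big_nat_cond; apply: eq_bigr => r; rewrite andbT => /andP[r1 rN].
  have p : (k - r)%:R != 0 :> R by rewrite pnatr_eq0; lia.
  apply: (mulIf p); rewrite mulrBl !divfK // mul1r natrB ?subKr //; lia.
have cheb : s * A <= \sum_(1 <= r < N.+1) D r / (k - r)%:R.
  have -> : \sum_(1 <= r < N.+1) D r / (k - r)%:R = \sum_(1 <= r < N.+1) a r * (D r / r%:R).
    rewrite big_nat_cond [RHS]big_nat_cond; apply: eq_bigr => r; rewrite andbT => /andP[r1 rN].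
    have p : r%:R != 0 :> R by rewrite pnatr_eq0; lia.
    by rewrite /a mulrACA [r%:R * D r]mulrC mulrACA divff // mulr1 mulrC.
  apply: le_trans (@chebyshev_weighted_mean D k a N sD _ _).
  - by apply: ler_wpM2r => //; apply: (@weighted_mean_homo D k) => //; rewrite /N; lia.
  - by rewrite /N; lia.
  - move=> r rN; rewrite /a ler_pM ?invr_ge0 ?ler0n ?ler_nat //.
    by rewrite lef_pV2 ?posrE ?ltr0n ?ler_nat; lia.
have Dk : k%:R * s <= x k.
  apply: le_trans (_ : D k <= _); last first.
    by have := @increment_min_le x k k 0 (leqnn _); rewrite x0 subr0.
  apply: le_trans (@weighted_sum_le D k k sD _); last by lia.
  rewrite mulrC -ler_pdivlMr; last by rewrite ltr0n; lia.
  by apply: (@weighted_mean_homo D k) => //; lia.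
have up : \sum_(1 <= r < N.+1) x (k - r)%N / (k - r)%:R <=
    x k * h - \sum_(1 <= r < N.+1) D r / (k - r)%:R.
  rewrite /h mulr_sumr -sumrB big_nat_cond [leRHS]big_nat_cond.
  apply: ler_sum => r; rewrite andbT => /andP[r1 rN].
  rewrite -mulrBl ler_wpM2r ?invr_ge0 ?ler0n //.
  have := increment_min_le x (_ : (k - r + r <= k)%N).
  rewrite subnK; last by lia.
  by move=> /(_ (leqnn _)); rewrite /D; lra.
have -> : weighted_sum x k = weighted_sum x t +
    \sum_(1 <= r < N.+1) x (k - r)%N / (k - r)%:R + x k / k%:R.
  rewrite /weighted_sum big_nat_recr //=; last by lia.
  by rewrite (@sum_split_rev (fun j => x j / j%:R) k N Nk) kN.
rewrite Sts; rewrite hh in ht.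
have Ntk : N%:R + t%:R + 1 = k%:R :> R by rewrite -natrD natr1; congr (_%:R); rewrite /N; lia.
have := mulr_ge0 (_ : 0 <= x k - k%:R * s) (_ : 0 <= 1 - (h + k%:R^-1)).
rewrite !subr_ge0 => /(_ Dk ht).
have : k%:R * k%:R^-1 = 1 :> R by rewrite divff.
move: (k%:R^-1 : R) up cheb => kV; move: (\sum_(_ <= _ < _) D _ / _) => Q.
rewrite AE.
move: (\sum_(_ <= _ < _) _) => W.
move: (k%:R : R) (N%:R : R) (t%:R : R) (x k) Ntk => K n' t' X <- up cheb e1 e2.
nra.
Qed.

Lemma prod_le_weighted_sum x k : (0 < k)%N -> (forall i, 0 <= x i) ->
  \prod_(1 <= i < k.+1) x i <= k`!%:R * (weighted_sum x k / k%:R) ^+ k.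
Proof.
move=> k0 xge.
have := leif_AGM (A := predT) (E := fun i : 'I_k => x i.+1 / i.+1%:R) _.
rewrite cardT size_enum_ord => -[|+ _].
  by move=> i _; rewrite mulr_ge0 ?invr_ge0 ?ler0n.
have -> : \sum_(i in 'I_k) x i.+1 / i.+1%:R = weighted_sum x k.
  by rewrite /weighted_sum big_add1 big_mkord.
move=> h; have -> : \prod_(1 <= i < k.+1) x i =
    k`!%:R * \prod_(i in 'I_k) (x i.+1 / i.+1%:R).
  rewrite fact_prod natr_prod !big_add1 /= !big_mkord -big_split /=.
  by apply: eq_bigr => i _; rewrite mulrC divfK // pnatr_eq0.
by apply: ler_wpM2l => //; rewrite ler0n.
Qed.
End Superadditive.

(** * Cylinders of a symmetric set of tuples *)

Section Cylinders.
Variables (R : realType) (T V : finType) (Om : {set {ffun T -> V}}).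
Implicit Types (J K S : {set T}) (w : {ffun T -> V}) (s : {perm T}).

Definition cyl J w := [set w' in Om | [forall i in J, w' i == w i]].

Lemma cylP J w w' : reflect (w' \in Om /\ {in J, w' =1 w}) (w' \in cyl J w).
Proof.
rewrite inE; apply: (iffP andP) => -[Ow h]; split=> //.
  by move=> i iJ; apply/eqP; move/forall_inP: h; apply.
by apply/forall_inP => i iJ; apply/eqP/h.
Qed.

Lemma mem_cyl J w : w \in Om -> w \in cyl J w.
Proof. by move=> wO; apply/cylP. Qed.

Lemma cyl_eq J w w' : w' \in cyl J w -> cyl J w' = cyl J w.
Proof.
move=> /cylP[_ h]; apply/setP => u; apply/cylP/cylP => -[uO hu]; split=> // i iJ.
  by rewrite hu // h.
by rewrite hu // h.
Qed.

Lemma cyl_subset K S w w' : K \subset S -> w' \in cyl S w -> w' \in cyl K w.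
Proof.
move=> KS /cylP[wO h]; apply/cylP; split=> // i iK.
by apply: h; apply: (fintype.subsetP KS).
Qed.

Lemma cyl_sym J w w' : w \in Om -> w' \in cyl J w -> w \in cyl J w'.
Proof. by move=> wO /cyl_eq ->; apply: mem_cyl. Qed.

Lemma cylU1 J l w w' : (w' \in cyl (l |: J) w) = (w' \in cyl J w) && (w' l == w l).
Proof.
apply/cylP/andP => [[wO h]|[/cylP[wO h] /eqP hl]].
  split; last by apply/eqP/h; rewrite !inE eqxx.
  by apply/cylP; split=> // i iJ; apply: h; rewrite !inE iJ orbT.
by split=> // i; rewrite !inE => /orP[/eqP -> //|/h].
Qed.

Lemma cyl0 w : cyl finset.set0 w = Om.
Proof.
apply/setP => u; apply/cylP/idP => [[]//|uO]; split=> // i; by rewrite inE.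
Qed.

Lemma card_cyl_gt0 J w : w \in Om -> (0 < #|cyl J w|)%N.
Proof. by move=> /(mem_cyl J) h; apply/card_gt0P; exists w. Qed.

Local Open Scope ring_scope.

Lemma card_cylR_gt0 J w : w \in Om -> 0 < #|cyl J w|%:R :> R.
Proof. by move=> /(card_cyl_gt0 J); rewrite ltr0n. Qed.

Lemma sum_cyl_mean S (f : {ffun T -> V} -> R) :
  \sum_(w in Om) (\sum_(w' in cyl S w) f w') / #|cyl S w|%:R = \sum_(w in Om) f w.
Proof.
under eq_bigr do rewrite mulr_suml.
rewrite (exchange_big_dep (mem Om)) /=; last by move=> w w' _ /cylP[].
apply: eq_bigr => w wO.
have -> : \sum_(i in Om | w \in cyl S i) f w / #|cyl S i|%:R =
    \sum_(i in cyl S w) f w / #|cyl S w|%:R.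
  apply: eq_big => [i|i /andP[iO /cyl_eq ->] //].
  apply/andP/idP => [[iO /cyl_sym]|h]; first exact.
  by split; [case/cylP: h | apply: cyl_sym].
by rewrite sumr_const -[LHS]mulr_natr divfK // gt_eqF // card_cylR_gt0.
Qed.

(** The tuples of [cyl S w] with value [v] at [l], if any, form a single cylinder, and the weights
    on it add up to one. *)
Lemma sum_cylU1_inv S l w v :
  \sum_(u in cyl S w | u l == v) (#|cyl (l |: S) u|%:R)^-1 =
  [exists u in cyl S w, u l == v]%:R :> R.
Proof.
case: (boolP [exists u in cyl S w, u l == v]) => [/exists_inP[u uw ul]|no].
  have h : [pred u in cyl S w | u l == v] =i cyl (l |: S) u.
    move=> x; rewrite cylU1 inE (cyl_eq uw); by rewrite (eqP ul).
  rewrite (eq_bigl (mem (cyl (l |: S) u))); last by move=> x; exact: (h x).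
  rewrite (eq_bigr (fun _ => (#|cyl (l |: S) u|%:R)^-1)); last by move=> x /cyl_eq ->.
  rewrite sumr_const -[LHS]mulr_natr mulVf // gt_eqF // card_cylR_gt0 //.
  by case/cylP: uw.
rewrite big1 // => u /andP[uw ul]; case/negP: no.
by apply/exists_inP; exists u.
Qed.

(** For a uniform random tuple of [Om]: the conditional probability of [w l] given [w] on [K],
    divided by the one given [w] on [S]. *)
Definition cyl_ratio K S l w : R :=
  #|cyl (l |: K) w|%:R * #|cyl S w|%:R / (#|cyl K w|%:R * #|cyl (l |: S) w|%:R).

(** Keeping [l] and [l'] separate lets values possible at different coordinates be compared at a
    common one. *)
Definition cyl_hit K S l l' w :=
  [set w' in cyl K w | [exists u in cyl S w, u l == w' l']].

(** Averaging the ratio over [cyl S w] cancels the probabilities given [S]. What remains is the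
    probability, given [w] on [K], that coordinate [l] takes a value possible given [w] on [S]. *)
Lemma sum_cyl_ratio K S l : K \subset S ->
  \sum_(w in Om) cyl_ratio K S l w =
  \sum_(w in Om) #|cyl_hit K S l l w|%:R / #|cyl K w|%:R.
Proof.
move=> KS; rewrite -(sum_cyl_mean S); apply: eq_bigr => w wO.
have cS : #|cyl S w|%:R != 0 :> R by rewrite gt_eqF // card_cylR_gt0.
have cK : #|cyl K w|%:R != 0 :> R by rewrite gt_eqF // card_cylR_gt0.
rewrite (eq_bigr (fun u : {ffun T -> V} => \sum_(w' in cyl K w | u l == w' l)
    (#|cyl (l |: S) u|%:R)^-1 * (#|cyl S w|%:R / #|cyl K w|%:R))); last first.
  move=> u uS; have uK := cyl_subset KS uS.
  rewrite -big_distrl /= sumr_const /cyl_ratio (cyl_eq uS) (cyl_eq uK).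
  have -> : #|[pred w' in cyl K w | u l == w' l]| = #|cyl (l |: K) u|.
    by apply: eq_card => x; rewrite cylU1 inE (cyl_eq uK) eq_sym.
  by rewrite -[X in _ = X * _]mulr_natl invfM; ring.
rewrite (exchange_big_dep (mem (cyl K w))) //=; last by move=> u w' _ /andP[].
rewrite (eq_bigr (fun w' : {ffun T -> V} => [exists u in cyl S w, u l == w' l]%:R *
    (#|cyl S w|%:R / #|cyl K w|%:R))); last first.
  move=> w' w'K; rewrite -sum_cylU1_inv -big_distrl /=; congr (_ * _).
  by apply: eq_bigl => u; rewrite w'K.
rewrite -big_distrl /= mulrA mulrAC mulfK //; congr (_ / _).
rewrite -natr_sum -big_mkcondr sum1_card; congr (_%:R).
by apply: eq_card => u; rewrite [RHS]inE.
Qed.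

(** * Invariance under permutations of the coordinates *)

Hypothesis Om_sym : forall s w, w \in Om -> [ffun i => w (s i)] \in Om.

Definition permute s w : {ffun T -> V} := [ffun i => w (s i)].

Lemma permute_inj s : injective (permute s).
Proof.
move=> w w' /ffunP h; apply/ffunP => i.
by have := h ((s^-1)%g i); rewrite !ffunE permKV.
Qed.

Lemma permuteKV s w : permute s (permute (s^-1)%g w) = w.
Proof. by apply/ffunP => i; rewrite !ffunE permK. Qed.

Lemma permute_Om s w : (permute s w \in Om) = (w \in Om).
Proof.
apply/idP/idP; last exact: Om_sym.
move=> /(Om_sym (s^-1)%g); rewrite [X in X \in _](_ : _ = w) //.
by apply/ffunP => i; rewrite !ffunE permKV.
Qed.

Lemma cyl_permute s J w : cyl J (permute s w) = [set permute s u | u in cyl (s @: J) w].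
Proof.
apply/setP => u; apply/idP/imsetP => [/cylP[uO h]|[u' /cylP[u'O h] ->]].
  exists (permute (s^-1)%g u); last by rewrite permuteKV.
  apply/cylP; split; first by rewrite permute_Om.
  by move=> _ /imsetP[i iJ ->]; rewrite ffunE permK h // ffunE.
apply/cylP; split; first by rewrite permute_Om.
by move=> i iJ; rewrite !ffunE h // imset_f.
Qed.

(** The conditional entropy of a uniform random tuple of [Om] given its coordinates in [J]. Thus
    [mean_ln_cyl J - mean_ln_cyl (l |: J)] is the entropy of coordinate [l] given those in [J]. *)
Definition mean_ln_cyl J : R := (\sum_(w in Om) ln #|cyl J w|%:R) / #|Om|%:R.

Lemma mean_ln_cyl_perm s J : mean_ln_cyl (s @: J) = mean_ln_cyl J.
Proof.
congr (_ / _); rewrite [RHS](reindex_inj (@permute_inj s)) /=.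
apply: eq_big => [w|w _]; first by rewrite permute_Om.
by rewrite cyl_permute card_imset //; apply: permute_inj.
Qed.

(** Transposing an element of [J :\: J'] with one of [J' :\: J] brings [J] closer to [J'] and keeps
    the mean. *)
Lemma mean_ln_cyl_card J J' : #|J| = #|J'| -> mean_ln_cyl J = mean_ln_cyl J'.
Proof.
have [n] := ubnP #|J :\: J'|; elim: n J => // n IH J hn JJ'.
have [JJ|/fintype.subsetPn[i iJ iJ']] := boolP (J \subset J').
  by congr mean_ln_cyl; apply/eqP; rewrite eqEcard JJ JJ' leqnn.
have : ~~ (J' \subset J).
  apply/negP => J'J; have/eqP e : J' == J by rewrite eqEcard J'J JJ' leqnn.
  by rewrite e iJ in iJ'.
move=> /fintype.subsetPn[j jJ' jJ]; rewrite -(mean_ln_cyl_perm (tperm i j) J).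
apply: IH; last by rewrite card_imset //; apply: perm_inj.
rewrite ltnS in hn; apply: leq_trans hn; apply: proper_card; apply/properP; split.
  apply/fintype.subsetP => y; rewrite !inE => /andP[yJ' /imsetP[x xJ E]]; rewrite yJ' /=.
  move: E yJ'; by case: tpermP => [_|xj|_ _] -> //; rewrite jJ'.
exists i; first by rewrite !inE iJ iJ'.
rewrite !inE iJ' /=; apply/imsetP => -[x xJ].
case: tpermP => [_ ij|xj _|]; last by move=> h _ e; apply: h.
  by rewrite -ij iJ in jJ.
by rewrite -xj xJ in jJ.
Qed.

(** The transposition of [l] and [l'] fixes [K] pointwise and maps the first set into the second. *)
Lemma cyl_hit_swap K S l l' w : l \notin K -> l' \notin K ->
  (#|cyl_hit K S l' l' w| <= #|cyl_hit K S l' l w|)%N.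
Proof.
move=> lK l'K; rewrite -(card_imset _ (@permute_inj (tperm l l'))).
apply/subset_leq_card/fintype.subsetP => _ /imsetP[u + ->].
rewrite !inE => /andP[/andP[uO /forall_inP h] e]; rewrite permute_Om uO /=.
apply/andP; split; last by rewrite ffunE tpermL.
apply/forall_inP => i iK; rewrite ffunE tpermD ?h //.
  by apply: contraNneq lK => ->.
by apply: contraNneq l'K => ->.
Qed.

(** Once both hit sets are moved to coordinate [l], they are disjoint subsets of [cyl K w], so their
    probabilities given [w] on [K] add up to at most one. *)
Lemma sum_cyl_ratio_le K S S' l l' : K \subset S -> K \subset S' ->
  l \notin K -> l' \notin K ->
  (forall w u u', w \in Om -> u \in cyl S w -> u' \in cyl S' w -> u l != u' l') ->
  \sum_(w in Om) cyl_ratio K S l w + \sum_(w in Om) cyl_ratio K S' l' w <= #|Om|%:R.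
Proof.
move=> KS KS' lK l'K dis; rewrite !sum_cyl_ratio // -big_split /=.
rewrite -[leRHS]mulr1n -sumr_const; apply: ler_sum => w wO.
rewrite -mulrDl ler_pdivrMr ?card_cylR_gt0 // mul1r -natrD ler_nat.
apply: leq_trans (leq_add (leqnn _) (cyl_hit_swap _ _ lK l'K)) _.
rewrite -cardsUI [X in (_ + X)%N](_ : _ = 0%N).
  rewrite addn0; apply/subset_leq_card/fintype.subsetP => u.
  by rewrite inE => /orP[] /setIdP[].
apply/eqP; rewrite cards_eq0; apply/eqP/setP => x; rewrite finset.in_set0; apply/negP.
rewrite inE => /andP[/setIdP[xK /exists_inP[u uS /eqP e]] /setIdP[_ /exists_inP[u' u'S /eqP e']]].
by have := dis _ _ _ wO uS u'S; rewrite e e' eqxx.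
Qed.

End Cylinders.

(** * Conditional entropies and the mean inequality *)

Lemma geometric_le_arithmetic_mean (R : realType) (W : finType) (A : {set W})
    (z : W -> R) :
  (0 < #|A|)%N -> (forall w, w \in A -> 0 < z w)%R ->
  (expR ((\sum_(w in A) ln (z w)) / #|A|%:R) <=
   (\sum_(w in A) z w) / #|A|%:R)%R.
Proof.
rewrite -(ltr0n R) => A0 z0; set m := ((\sum_(w in A) ln (z w)) / _)%R.
rewrite ler_pdivlMr // mulrC -ler_pdivlMr ?expR_gt0 // mulr_suml.
(* The deviations from the mean [m] cancel, so [1 + x <= expR x] can be applied termwise. *)
have -> : (#|A|%:R = \sum_(w in A) (1 + (ln (z w) - m)))%R.
  by rewrite big_split /= sumrB !sumr_const -[(m *+ _)%R]mulr_natr /m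
    divfK ?gt_eqF // subrr addr0.
apply: ler_sum => w /z0 zw; apply: le_trans (expR_ge1Dx _) _.
by rewrite expRB lnK.
Qed.

Section MeanLn.
Local Open Scope ring_scope.
Variables (R : realType) (T V : finType) (Om : {set {ffun T -> V}}).
Hypothesis Om_sym : forall (s : {perm T}) w, w \in Om -> [ffun i => w (s i)] \in Om.
Hypothesis Om_gt0 : (0 < #|Om|)%N.
Implicit Types (K S : {set T}) (l : T) (u w : {ffun T -> V}).
Local Notation cyl := (cyl Om).
Local Notation mlc := (mean_ln_cyl R Om).

Lemma expR_mean_ln_cyl_ratio K S l :
  expR ((mlc S - mlc (l |: S)) - (mlc K - mlc (l |: K))) <=
  (\sum_(w in Om) cyl_ratio R Om K S l w) / #|Om|%:R.
Proof.
have -> : (mlc S - mlc (l |: S)) - (mlc K - mlc (l |: K)) =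
    (\sum_(w in Om) ln (cyl_ratio R Om K S l w)) / #|Om|%:R.
  rewrite /mean_ln_cyl -!mulrBl -!sumrB; congr (_ / _); apply: eq_bigr => w wO.
  rewrite /cyl_ratio ln_div ?lnM ?posrE ?mulr_gt0 ?card_cylR_gt0 //; ring.
apply: geometric_le_arithmetic_mean => // w wO.
by rewrite /cyl_ratio divr_gt0 ?mulr_gt0 ?card_cylR_gt0.
Qed.

(** Divided by the right-hand side, the terms on the left are geometric means of [cyl_ratio], and
    the matching arithmetic means add up to at most one. Symmetry exchanges [l] and [l'] over
    [K]. *)
Lemma expR_mean_ln_cyl_superadditive K S S' l l' : K \subset S -> K \subset S' ->
  l \notin K -> l' \notin K ->
  (forall w u u', w \in Om -> u \in cyl S w -> u' \in cyl S' w -> u l != u' l') ->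
  expR (mlc S - mlc (l |: S)) + expR (mlc S' - mlc (l' |: S')) <=
  expR (mlc K - mlc (l |: K)).
Proof.
move=> KS KS' lK l'K dis.
have e : mlc (l |: K) = mlc (l' |: K).
  by apply: mean_ln_cyl_card => //; rewrite !cardsU1 lK l'K.
rewrite -[leRHS]mul1r -ler_pdivrMr ?expR_gt0 // mulrDl.
rewrite -!expRB [X in _ + expR (_ - (_ - X))]e.
apply: le_trans (lerD (expR_mean_ln_cyl_ratio K S l) (expR_mean_ln_cyl_ratio K S' l')) _.
rewrite -mulrDl ler_pdivrMr ?ltr0n // mul1r.
exact: sum_cyl_ratio_le.
Qed.

Lemma mean_ln_cyl0 : mlc finset.set0 = ln #|Om|%:R.
Proof.
rewrite /mean_ln_cyl (eq_bigr (fun _ => ln #|Om|%:R)); last by move=> w _; rewrite cyl0.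
by rewrite sumr_const -[X in X / _]mulr_natr mulfK // pnatr_eq0 -lt0n.
Qed.

Lemma mean_ln_cylT : mlc [set: T] = 0.
Proof.
rewrite /mean_ln_cyl big1 ?mul0r // => w wO.
suff -> : cyl [set: T] w = [set w] by rewrite cards1 ln1.
apply/setP => u; rewrite inE; apply/cylP/eqP => [[_ h]|->]; last by split.
by apply/ffunP => i; apply: h; rewrite inE.
Qed.

(** This bounds the entropy of one coordinate: the mean of the inverse probabilities of its values
    counts the values that occur. *)
Lemma expR_mean_ln_cyl1 l : expR (ln #|Om|%:R - mlc [set l]) <= #|V|%:R.
Proof.
have := geometric_le_arithmetic_mean Om_gt0 (z := fun w => #|Om|%:R / #|cyl [set l] w|%:R : R).
rewrite /=.
have -> : (\sum_(w in Om) ln (#|Om|%:R / #|cyl [set l] w|%:R)) / #|Om|%:R =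
    ln #|Om|%:R - mlc [set l].
  rewrite -mean_ln_cyl0 /mean_ln_cyl -mulrBl -sumrB; congr (_ / _); apply: eq_bigr => w wO.
  by rewrite cyl0 ln_div ?posrE ?ltr0n ?card_cyl_gt0.
move=> /(_ _)/le_trans; apply; first by move=> w wO; rewrite divr_gt0 ?ltr0n ?card_cyl_gt0.
rewrite -big_distrr /= mulrAC divff ?mul1r ?pnatr_eq0 -?lt0n //.
have [w wO] : exists w, w \in Om by apply/card_gt0P.
rewrite (partition_big (fun w : {ffun T -> V} => w l) predT) //=.
apply: le_trans (_ : \sum_(v : V) 1 <= _); last by rewrite sumr_const.
apply: ler_sum => v _.
have := sum_cylU1_inv R Om finset.set0 l w v.
rewrite cyl0 finset.setU0 => ->.
by rewrite -[1]/(1%:R) ler_nat leq_b1.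
Qed.

End MeanLn.

(** * Ordered edges and tent images *)

Definition ordered_edges (k : nat) (V : finType) (E : {set {set V}}) :
    {set {ffun 'I_k -> V}} :=
  [set w : {ffun 'I_k -> V} | injectiveb w & w @: [set: 'I_k] \in E].

(* A homomorphic image of the (k - i, i)-tent amounts to an edge A with parts I
   and A \ I, |I| = i, and a vertex v outside A extending both parts inside
   edges. *)
Definition no_tent_image (t : nat) (V : finType) (E : {set {set V}}) : Prop :=
  forall (A B C I : {set V}) v, A \in E -> B \in E -> C \in E -> I \subset A ->
    0 < #|I| <= t -> v \notin A -> v |: I \subset B ->
    v |: (A :\: I) \subset C -> False.

Lemma card_ord_prefix k m : m <= k -> #|[set x : 'I_k | x < m]| = m.
Proof.
move=> mk; have -> : [set x : 'I_k | x < m] = widen_ord mk @: [set: 'I_m].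
  apply/setP => x; rewrite inE; apply/idP/imsetP => [xk|[y _ ->]]; last exact: (ltn_ord y).
  by exists (Ordinal xk) => //; apply: val_inj.
by rewrite card_imset ?cardsT ?card_ord // => x y /(congr1 val) /= xy; apply: val_inj.
Qed.

Section OrderedEdges.
Variables (k : nat) (V : finType) (E : {set {set V}}).
Local Notation Om := (@ordered_edges k V E).

Lemma ordered_edgesP (w : {ffun 'I_k -> V}) :
  reflect (injective w /\ w @: [set: 'I_k] \in E) (w \in Om).
Proof.
by rewrite inE; apply: (iffP andP) => -[h1 h2]; split => //; apply/injectiveP.
Qed.

Lemma ordered_edges_sym (s : {perm 'I_k}) (w : {ffun 'I_k -> V}) :
  w \in Om -> [ffun i => w (s i)] \in Om.
Proof.
move=> /ordered_edgesP[winj wE]; apply/ordered_edgesP; split.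
  by move=> i j; rewrite !ffunE => /winj /perm_inj.
suff -> : [ffun i => w (s i)] @: [set: 'I_k] = w @: [set: 'I_k] by [].
apply/setP => v; apply/imsetP/imsetP => -[i _ ->].
  by exists (s i); rewrite // ffunE.
by exists ((s^-1)%g i); rewrite // ffunE permKV.
Qed.

Lemma card_ordered_edges : (forall e, e \in E -> #|e| = k) -> #|Om| = k`! * #|E|.
Proof.
move=> uE; rewrite -sum1_card.
rewrite (partition_big (fun w : {ffun 'I_k -> V} => w @: [set: 'I_k]) (mem E)) /=; last first.
  by move=> w /ordered_edgesP[].
rewrite mulnC -sum_nat_const; apply: eq_bigr => e eE.
have -> : k`! = #|e| ^_ #|'I_k| by rewrite uE // card_ord ffactnn.
rewrite sum1_card -card_inj_ffuns_on; apply: eq_card => w; rewrite [RHS]inE.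
rewrite -[LHS]/((w \in Om) && (w @: [set: 'I_k] == e)).
apply/andP/andP => -[].
  move=> /ordered_edgesP[winj _] /eqP we; split; last by apply/injectiveP.
  by apply/ffun_onP => i; rewrite -we imset_f.
move=> /ffun_onP we /injectiveP winj.
have e1 : w @: [set: 'I_k] == e.
  rewrite eqEcard card_imset // cardsT card_ord uE // leqnn andbT.
  by apply/fintype.subsetP => _ /imsetP[i _ ->]; apply: we.
by split => //; apply/ordered_edgesP; rewrite (eqP e1).
Qed.

(** A common value [v] would give a tent image: [w] spans the edge [A], its last [i] coordinates
    form [I], and [u] and [u'] span edges that contain [v] together with [A :\: I] and [I]
    respectively. *)
Lemma ordered_edges_disjoint (t i j : nat) : no_tent_image t E ->
  0 < i <= t -> 0 < j -> i + j <= k ->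
  forall (l l' : 'I_k) (w u u' : {ffun 'I_k -> V}),
    val l = k - i -> val l' = k - i - j -> w \in Om ->
    u \in cyl Om [set x : 'I_k | x < k - i] w ->
    u' \in cyl Om [set x : 'I_k | (x < k - i - j) || (k - i <= x)] w ->
    u l != u' l'.
Proof.
move=> nt it j0 ijk l l' w u u' hl hl' wO /cylP[uO hu] /cylP[u'O hu']; apply/eqP => e.
have [winj wE] := ordered_edgesP _ wO.
have [uinj uE] := ordered_edgesP _ uO.
have [u'inj u'E] := ordered_edgesP _ u'O.
pose J := [set x : 'I_k | k - i <= x].
apply: (nt (w @: [set: 'I_k]) (u' @: [set: 'I_k]) (u @: [set: 'I_k]) (w @: J) (u l)) => //.
- by apply: imsetS; apply: finset.subsetT.
- rewrite card_imset //; suff -> : #|J| = i by [].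
  have := cardsC J; rewrite card_ord.
  have -> : #|~: J| = k - i.
    have -> : ~: J = [set x : 'I_k | x < k - i] by apply/setP => x; rewrite !inE -ltnNge.
    by rewrite card_ord_prefix ?leq_subr.
  lia.
- apply/negP => /imsetP[x _ ex]; case: (ltnP x (k - i)) => xk.
    have : u x = u l by rewrite hu ?inE // ex.
    by move/uinj => xl; move: xk; rewrite xl hl ltnn.
  have : u' x = u' l' by rewrite hu' ?inE ?xk ?orbT // -ex e.
  by move/u'inj => xl; move: xk; rewrite xl hl'; lia.
- apply/fintype.subsetP => y; rewrite inE => /orP[|/imsetP[x]].
    by rewrite inE => /eqP ->; rewrite e imset_f.
  by rewrite inE => xk ->; rewrite -hu' ?inE ?xk ?orbT // imset_f.
- apply/fintype.subsetP => y; rewrite inE => /orP[|].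
    by rewrite inE => /eqP ->; rewrite imset_f.
  rewrite inE => /andP[yJ /imsetP[x _ yx]].
  have xk : x < k - i by rewrite ltnNge; apply: contra yJ => xk; rewrite yx imset_f // inE.
  by rewrite yx -hu ?inE // imset_f.
Qed.

End OrderedEdges.

(** * Entropy ratios of a random ordered edge *)

Section EntropyRatios.
Variables (R : realType) (k t : nat) (V : finType) (E : {set {set V}}).
Hypothesis ntE : no_tent_image t E.
Hypothesis uE : forall e, e \in E -> #|e| = k.
Hypothesis E0 : 0 < #|E|.
Local Notation Om := (@ordered_edges k V E).
Local Open Scope ring_scope.

Definition prefix_mean (m : nat) : R := mean_ln_cyl R Om [set x : 'I_k | (x < m)%N].

(* The exponential of the conditional entropy of a vertex of a uniformly random
   ordered edge given k - i others. *)
Definition entropy_ratio (i : nat) : R :=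
  if i is 0%N then 0 else expR (prefix_mean (k - i) - prefix_mean (k - i).+1).

Lemma entropy_ratio_ge0 i : 0 <= entropy_ratio i.
Proof. by case: i => //= i; apply: expR_ge0. Qed.

Lemma entropy_ratioE i : (0 < i)%N ->
  entropy_ratio i = expR (prefix_mean (k - i) - prefix_mean (k - i).+1).
Proof. by case: i. Qed.

Lemma ordered_edges_gt0 : (0 < #|Om|)%N.
Proof. by rewrite card_ordered_edges // muln_gt0 fact_gt0. Qed.

Lemma prefixS (l : 'I_k) : [set x : 'I_k | (x < l.+1)%N] = l |: [set x : 'I_k | (x < l)%N].
Proof. by apply/setP => x; rewrite !inE ltnS leq_eqVlt. Qed.

(** [S'] consists of [K] and the last [i] coordinates, so it has [k - j] elements; by symmetry a
    prefix of that length has the same mean. *)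
Lemma entropy_ratio_superadditive i j : (0 < i <= t)%N -> (0 < j)%N -> (i + j <= k)%N ->
  entropy_ratio i + entropy_ratio j <= entropy_ratio (i + j).
Proof.
move=> it j0 ijk.
have lk : (k - i < k)%N by lia.
have lk' : (k - i - j < k)%N by lia.
pose l := Ordinal lk; pose l' := Ordinal lk'.
pose K := [set x : 'I_k | (x < k - i - j)%N].
pose S := [set x : 'I_k | (x < k - i)%N].
pose S' := [set x : 'I_k | (x < k - i - j) || (k - i <= x)]%N.
have sym := @ordered_edges_sym k V E.
have cardS' : #|S'| = #|[set x : 'I_k | (x < k - j)%N]|.
  rewrite card_ord_prefix ?leq_subr //.
  have -> : S' = K :|: ~: S by apply/setP => x; rewrite !inE -leqNgt.
  rewrite cardsU [K :&: _](_ : _ = finset.set0) ?cards0 ?subn0.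
    by have := cardsC S; rewrite card_ord !card_ord_prefix; lia.
  by apply/setP => x; rewrite !inE; lia.
have eS : l |: S = [set x : 'I_k | (x < (k - i).+1)%N] by rewrite -(prefixS l).
have eS' : mean_ln_cyl R Om (l' |: S') = prefix_mean (k - j).+1.
  apply: mean_ln_cyl_card => //.
  have lkj : (k - j < k)%N by lia.
  rewrite (prefixS (Ordinal lkj)) !cardsU1 cardS' !inE /= ltnn; congr (nat_of_bool _ + _)%N.
  lia.
have eK : mean_ln_cyl R Om (l |: K) = prefix_mean (k - i - j).+1.
  apply: mean_ln_cyl_card => //.
  rewrite (prefixS l') !cardsU1 !inE /= ltnn; congr (nat_of_bool _ + _)%N; lia.
have eSS : mean_ln_cyl R Om S' = prefix_mean (k - j) by apply: mean_ln_cyl_card.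
rewrite !entropy_ratioE ?addn_gt0 ?j0 ?orbT //; last by case/andP: it.
rewrite subnDA -eK -eS' -eSS /prefix_mean -eS -/S -/K.
apply: expR_mean_ln_cyl_superadditive => //.
- exact: ordered_edges_gt0.
- by apply/fintype.subsetP => x; rewrite !inE; lia.
- by apply/fintype.subsetP => x; rewrite !inE => ->.
- by rewrite inE /=; lia.
- by rewrite inE /= ltnn.
- by move=> w u u' wO uS u'S; apply: (ordered_edges_disjoint ntE it j0 ijk _ _ wO uS u'S).
Qed.

(** Chain rule: the exponents telescope to the entropy of the whole tuple, which is the logarithm of
    the number of ordered edges. *)
Lemma prod_entropy_ratio : \prod_(1 <= i < k.+1) entropy_ratio i = (k`! * #|E|)%:R.
Proof.
have h m : (m <= k)%N -> \prod_(1 <= i < m.+1) entropy_ratio i =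
    expR (prefix_mean (k - m) - prefix_mean k).
  elim: m => [|m IH] mk; first by rewrite big_geq // subn0 subrr expR0.
  rewrite big_nat_recr //= IH ?(ltnW mk) // -expRD; congr expR.
  have -> : (k - m = (k - m.+1).+1)%N by lia.
  ring.
rewrite h // subnn /prefix_mean.
have -> : [set x : 'I_k | (x < 0)%N] = finset.set0 by apply/setP => x; rewrite !inE.
have -> : [set x : 'I_k | (x < k)%N] = [set: 'I_k] by apply/setP => x; rewrite !inE ltn_ord.
rewrite mean_ln_cyl0 ?ordered_edges_gt0 // mean_ln_cylT subr0 lnK ?card_ordered_edges //.
by rewrite posrE ltr0n muln_gt0 fact_gt0.
Qed.

Lemma entropy_ratio_le_card : (0 < k)%N -> entropy_ratio k <= #|V|%:R.
Proof.
move=> k0; rewrite entropy_ratioE // subnn /prefix_mean (prefixS (Ordinal k0)) /=.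
have -> : [set x : 'I_k | (x < 0)%N] = finset.set0 by apply/setP => x; rewrite !inE.
rewrite mean_ln_cyl0 ?ordered_edges_gt0 // finset.setU0; apply: expR_mean_ln_cyl1; exact: ordered_edges_gt0.
Qed.
End EntropyRatios.

Lemma card_edges_le (R : realType) (k t : nat) (V : finType) (E : {set {set V}}) :
  (forall e, e \in E -> #|e| = k) -> no_tent_image t E -> 0 < t < k ->
  (\sum_(t.+1 <= j < k.+1) (j%:R)^-1 <= 1 :> R)%R ->
  #|E| * k ^ k <= #|V| ^ k.
Proof.
move=> uE ntE tk ht; have [->|E0] := posnP #|E|; first by rewrite mul0n.
have k0 : 0 < k by lia.
have h := prod_le_weighted_sum k0 (entropy_ratio_ge0 R k E).
rewrite (prod_entropy_ratio R uE E0) natrM ler_pM2l ?ltr0n ?fact_gt0 // in h.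
rewrite -(ler_nat R) natrM !natrX -ler_pdivlMr ?exprn_gt0 ?ltr0n // -expr_div_n.
apply: le_trans h _; rewrite lerXn2r ?nnegrE ?divr_ge0 ?ler0n //.
  apply: sumr_ge0 => i _; rewrite divr_ge0 ?ler0n //; exact: entropy_ratio_ge0.
rewrite ler_pM2r ?invr_gt0 ?ltr0n //.
apply: le_trans (entropy_ratio_le_card R uE E0 k0).
(* The convention [entropy_ratio 0 = 0] provides the hypothesis [x 0 = 0]. *)
apply: (@weighted_sum_le_partial _ _ k t) => //; first exact: entropy_ratio_ge0.
exact: entropy_ratio_superadditive.
Qed.

(** * Codegrees and tents *)

Definition min_codegree (V : finType) (k c : nat) (E : {set {set V}}) : Prop :=
  forall S : {set V}, #|S| = k.-1 -> (exists2 e, e \in E & S \subset e) ->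
    c <= #|[set e in E | S \subset e]|.

(** Take a subgraph maximizing [psi]. If some [S] had positive codegree below [c], deleting the
    edges over [S] would lose fewer than [c] edges and gain an unshadowed set, raising [psi]. *)
Lemma min_codegree_subgraph (V : finType) (k c : nat) (E : {set {set V}}) :
  exists E' : {set {set V}}, [/\ E' \subset E,
    #|E| <= #|E'| + c * 'C(#|V|, k.-1) & min_codegree k c E'].
Proof.
pose unshadowed (X : {set {set V}}) :=
  [set S : {set V} | (#|S| == k.-1) && [forall e in X, ~~ (S \subset e)]].
pose psi (X : {set {set V}}) := #|X| + c * #|unshadowed X|.
case: (@arg_maxnP _ E (fun X => X \subset E) psi (fintype.subxx _)) => X XE maxX.
exists X; split=> //.
  apply: leq_trans (leq_trans (maxX E (fintype.subxx _)) _); first exact: leq_addr.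
  rewrite leq_add2l leq_mul2l; apply/orP; right.
  rewrite -card_draws; apply/subset_leq_card/fintype.subsetP => S.
  by rewrite !inE => /andP[].
move=> S Sk [e eX Se]; pose Y := [set e in X | ~~ (S \subset e)].
have YX : Y \subset X by apply/fintype.subsetP => x; rewrite inE => /andP[].
have := maxX Y (fintype.subset_trans YX XE); rewrite /psi => h.
have SX : S \notin unshadowed X.
  by rewrite inE; apply/negP => /andP[_ /forall_inP /(_ e eX)]; rewrite Se.
have : #|S |: unshadowed X| <= #|unshadowed Y|.
  apply/subset_leq_card/fintype.subsetP => Q; rewrite inE => /orP[|].
    rewrite inE => /eqP ->; rewrite inE Sk eqxx /=.
    by apply/forall_inP => x; rewrite inE => /andP[].
  rewrite !inE => /andP[-> /forall_inP hQ] /=.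
  by apply/forall_inP => x xY; apply: hQ; apply: (fintype.subsetP YX).
rewrite cardsU1 SX add1n => lt.
have cX : #|X| = #|[set e in X | S \subset e]| + #|Y|.
  rewrite -(cardsID [set e : {set V} | S \subset e] X); congr (_ + _); apply: eq_card => x;
  by rewrite !inE // andbC.
nia.
Qed.

(** Remove a vertex [w] of [B] lying in [Z]. The rest of [B] has at least [c > #|Z|] extensions, so
    one of them adds no vertex of [Z]; repeat. *)
Lemma avoiding_edge (V : finType) (k c : nat) (E : {set {set V}}) (B S Z : {set V}) :
  (forall e, e \in E -> #|e| = k) -> min_codegree k c E -> B \in E -> S \subset B ->
  [disjoint S & Z] -> #|Z| < c -> exists2 B', B' \in E & S \subset B' /\ [disjoint B' & Z].
Proof.
move=> uE dE + + SZ Zc.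
have [m] := ubnP #|B :&: Z|; elim: m B => // m IH B hm BE SB.
have [BZ|BZ] := boolP [disjoint B & Z]; first by exists B.
have /finset.set0Pn[w] : B :&: Z != finset.set0 by rewrite finset.setI_eq0.
rewrite inE => /andP[wB wZ].
have wS : w \notin S by apply/negP => wS; rewrite (disjointFr SZ wS) in wZ.
pose Q := B :\ w.
have Qk : #|Q| = k.-1 by have := cardsD1 w B; rewrite wB uE // -/Q; lia.
have cQ : c <= #|[set e in E | Q \subset e]|.
  by apply: dE => //; exists B => //; apply: finset.subsetDl.
have : ~~ ([set e in E | Q \subset e] \subset (fun u => u |: Q) @: Z).
  apply/negP => /subset_leq_card h; have := leq_trans cQ (leq_trans h (leq_imset_card _ _)).
  by rewrite leqNgt Zc.
move=> /fintype.subsetPn[e]; rewrite inE => /andP[eE Qe] eZ.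
have eQ x : x \in e -> x \in Z -> x \in Q.
  move=> xe xZ; apply: contraNT eZ => xQ; apply/imsetP; exists x => //.
  apply/eqP; rewrite eq_sym eqEcard cardsU1 xQ Qk uE //.
  rewrite finset.subUset finset.sub1set xe Qe /=; have := uE _ BE; have := cardsD1 w B; rewrite wB; lia.
apply: (IH e) => //; last first.
  apply: fintype.subset_trans Qe; apply/fintype.subsetP => x xS.
  by rewrite !inE (fintype.subsetP SB) // andbT; apply: contraNneq wS => <-.
rewrite ltnS in hm; apply: leq_trans hm; apply: proper_card; apply/properP; split.
  apply/fintype.subsetP => x; rewrite !inE => /andP[xe xZ]; rewrite xZ andbT.
  by have := eQ x xe xZ; rewrite !inE => /andP[].
exists w; first by rewrite inE wB.
apply/negP; rewrite inE => /andP[we _]; have := eQ w we wZ; by rewrite !inE eqxx.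
Qed.

Lemma tent_copy (n k i : nat) (E : {set {set 'I_n}}) (A B C I : {set 'I_n}) (v : 'I_n) :
  0 < i < k -> (forall e, e \in E -> #|e| = k) ->
  A \in E -> B \in E -> C \in E -> I \subset A -> #|I| = i -> v \notin A ->
  v |: I \subset B -> v |: (A :\: I) \subset C ->
  [disjoint B & A :\: I] -> [disjoint C & B :\ v] ->
  has_copy (Hypergraph E) (tent k i).
Proof.
move=> ik uE AE BE CE IA Ii vA vIB vJC dBJ dCB.
pose l1 := enum I; pose l2 := enum (A :\: I).
pose l3 := enum (B :\: (v |: I)); pose l4 := enum (C :\: (v |: (A :\: I))).
(* Entry [x] of [L] is the image of tent vertex [x + 1]; in particular [v], at position [k], is the
   image of vertex [k + 1], shared by the second and third edges. *)
pose L := l1 ++ l2 ++ v :: l3 ++ l4.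
have vI : v \notin I by apply: contra vA => /(fintype.subsetP IA).
have vJ : v \notin A :\: I by rewrite inE negb_and vA orbT.
have IB x : x \in I -> x \in B.
  by move=> xI; apply: (fintype.subsetP vIB); rewrite inE xI orbT.
have JC x : x \in A :\: I -> x \in C.
  by move=> xI; apply: (fintype.subsetP vJC); rewrite inE xI orbT.
have vB : v \in B by apply: (fintype.subsetP vIB); rewrite !inE eqxx.
have vC : v \in C by apply: (fintype.subsetP vJC); rewrite !inE eqxx.
have cJ : #|A :\: I| = k - i by rewrite cardsDS // uE // Ii.
have s1 : size l1 = i by rewrite -cardE.
have s2 : size l2 = k - i by rewrite -cardE.
have s3 : size l3 = k - i - 1 by rewrite -cardE cardsDS // (uE _ BE) cardsU1 vI Ii -subnDA addnC.
have s4 : size l4 = i - 1.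
  by rewrite -cardE cardsDS // (uE _ CE) cardsU1 vJ cJ add1n; clear -ik; lia.
have sL : size L = 2 * k - 1 by rewrite !size_cat /= size_cat s1 s2 s3 s4; move: ik; clear; lia.
have n1 x : x < i -> nth v L x \in I.
  by move=> h; rewrite nth_cat s1 h -mem_enum; apply: mem_nth; rewrite s1.
have n2 x : i <= x < k -> nth v L x \in A :\: I.
  move=> h; rewrite nth_cat s1 ifN; last by move: ik h; clear; lia.
  rewrite nth_cat s2 ifT; last by move: ik h; clear; lia.
  by rewrite -mem_enum; apply: mem_nth; rewrite s2; move: ik h; clear; lia.
have n3 : nth v L k = v.
  rewrite nth_cat s1 ifN; last by move: ik; clear; lia.
  rewrite nth_cat s2 ifN; last by move: ik; clear; lia.
  by rewrite subnn.
have n4 x : k < x < 2 * k - i -> nth v L x \in B.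
  move=> h; rewrite nth_cat s1 ifN; last by move: ik h; clear; lia.
  rewrite nth_cat s2 ifN; last by move: ik h; clear; lia.
  have -> : x - i - (k - i) = (x - k).-1.+1 by move: ik h; clear; lia.
  rewrite /= nth_cat s3 ifT; last by move: ik h; clear; lia.
  have : nth v l3 (x - k).-1 \in l3 by apply: mem_nth; rewrite s3; move: ik h; clear; lia.
  by rewrite mem_enum inE => /andP[].
have n5 x : 2 * k - i <= x < 2 * k - 1 -> nth v L x \in C.
  move=> h; rewrite nth_cat s1 ifN; last by move: ik h; clear; lia.
  rewrite nth_cat s2 ifN; last by move: ik h; clear; lia.
  have -> : x - i - (k - i) = (x - k).-1.+1 by move: ik h; clear; lia.
  rewrite /= nth_cat s3 ifN; last by move: ik h; clear; lia.
  have : nth v l4 ((x - k).-1 - (k - i - 1)) \in l4.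
    by apply: mem_nth; rewrite s4; move: ik h; clear; lia.
  by rewrite mem_enum inE => /andP[].
have uL : uniq L.
  have dI x : x \in C -> x \in B -> x = v.
    move=> xC xB; apply/eqP; apply/negP => /negP xv.
    by have := disjointFr dCB xC; rewrite !inE xv xB.
  have nh (X Y : {set 'I_n}) : (forall x, x \in X -> x \in Y -> False) ->
      has (mem (enum X)) (enum Y) = false.
    move=> h; apply/hasP => -[x]; rewrite mem_enum => xY; rewrite /= mem_enum => xX.
    exact: h xX xY.
  have d12 : has (mem l1) l2 = false by apply: nh => x xI; rewrite inE xI.
  have d13 : has (mem l1) l3 = false by apply: nh => x xI; rewrite !inE xI orbT.
  have d14 : has (mem l1) l4 = false.
    apply: nh => x xI; rewrite !inE => /andP[/norP[xv _] xC].
    by move/eqP: xv; apply; apply: dI => //; apply: IB.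
  have d23 : has (mem l2) l3 = false.
    by apply: nh => x xJ; rewrite inE => /andP[_ xB]; rewrite (disjointFr dBJ xB) in xJ.
  have d24 : has (mem l2) l4 = false.
    apply: nh => x xJ; rewrite inE => /andP[/negP h _]; apply: h.
    by rewrite inE xJ orbT.
  have d34 : has (mem l3) l4 = false.
    apply: nh => x; rewrite !inE negb_or => /andP[/andP[xv _] xB] /andP[_ xC].
    by move/eqP: xv; apply; apply: dI.
  have nv (X : {set 'I_n}) : v \notin X -> (v \in enum X) = false.
    by rewrite mem_enum => /negbTE.
  rewrite !cat_uniq !has_cat /= !has_cat cat_uniq !enum_uniq d12 d13 d14 d23 d24 d34.
  by rewrite !mem_cat !nv // !inE eqxx.
pose f (x : 'I_(2 * k - 1)) := nth v L x.
have finj : injective f.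
  move=> x y /eqP; rewrite nth_uniq ?sL // => /eqP; exact: val_inj.
exists f; split=> // e eT.
(* As all edges have [k] vertices, mapping a tent edge into [X] already makes its image equal to
   [X]. *)
have im (X : {set 'I_n}) : X \in E -> (forall x, x \in e -> f x \in X) -> f @: e \in E.
  move=> XE h; suff -> : f @: e = X by [].
  apply/eqP; rewrite eqEcard card_imset // (tent_uniform ik eT) uE // leqnn andbT.
  by apply/fintype.subsetP => _ /imsetP[x xe ->]; apply: h.
move: im; move: eT; rewrite !inE => /orP[/orP[]|] /eqP -> im.
- apply: (im A) => // x; rewrite inE /= => xk; rewrite /f.
  case: (ltnP x i) => xi; first by apply: (fintype.subsetP IA); apply: n1.
  by have := n2 x; rewrite xi xk inE => /(_ isT) /andP[].
- apply: (im B) => // x; rewrite inE /= => xk; rewrite /f.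
  case: (ltnP x i) => xi; first by apply: IB; apply: n1.
  have [->|xk'] := eqVneq (nat_of_ord x) k; first by rewrite n3.
  by apply: n4; move: xi xk' xk; clear; case: x => /= x _; lia.
- apply: (im C) => // x; rewrite inE /= => xk; rewrite /f.
  have xl := ltn_ord x.
  case: (ltnP x k) => xi; first by apply: JC; apply: n2; move: xi xk ik; clear; case: x => /= x _; lia.
  have [->|xk'] := eqVneq (nat_of_ord x) k; first by rewrite n3.
  by apply: n5; move: xi xk' xk xl; clear; case: x => /= x _; lia.
Qed.

(** First move [B] off [A :\: I] while keeping [v |: I], then move [C] off the new [B] except at
    [v]. Each avoided set has at most [k] vertices, hence the codegree [k.+1]. *)
Lemma min_codegree_no_tent_image (n k t : nat) (E : {set {set 'I_n}}) :
  t < k -> (forall e, e \in E -> #|e| = k) -> min_codegree k k.+1 E ->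
  family_free (tents_up_to k t) (Hypergraph E) -> no_tent_image t E.
Proof.
move=> tk uE dE fE A B C I v AE BE CE IA It vA vIB vJC.
have [||B' B'E [vIB' dB']] := @avoiding_edge _ k k.+1 E B (v |: I) (A :\: I) uE dE BE vIB.
- rewrite -finset.setI_eq0; apply/eqP/setP => x; rewrite !inE; apply/negP.
  by move=> /and3P[/orP[/eqP ->|->] // _]; rewrite (negbTE vA).
- by rewrite ltnS -(uE _ AE) subset_leq_card // finset.subsetDl.
have [||C' C'E [vJC' dC']] := @avoiding_edge _ k k.+1 E C (v |: (A :\: I)) (B' :\ v) uE dE CE vJC.
- rewrite -finset.setI_eq0; apply/eqP/setP => x; rewrite finset.in_set0; apply/negP.
  rewrite inE => /andP[]; rewrite inE => /orP[|xJ]; first by rewrite !inE => ->.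
  by rewrite inE => /andP[_ xB]; rewrite (disjointFr dB' xB) in xJ.
- by rewrite ltnS -(uE _ B'E) subset_leq_card // finset.subsetDl.
apply: (fE (tent k #|I|)); first by exists #|I|.
apply: (@tent_copy _ _ _ _ A B' C' I v) => //.
by case/andP: It => -> /leq_ltn_trans ->.
Qed.

(** * Bounds on the Turan number *)

(** The first edge uses all [k] colours, so one of its vertices has the colour of vertex [k + 1];
    yet the second or third edge contains both. *)
Lemma partite_tent_free (n k i : nat) (col : 'I_n -> 'I_k) (E : {set {set 'I_n}}) :
  (forall e, e \in E -> {in e &, injective col}) -> 0 < i < k ->
  ~ has_copy (Hypergraph E) (tent k i).
Proof.
move=> colE ik [f [finj fE]].
have inj e : e \in hg_edges (tent k i) -> {in e &, injective (col \o f)}.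
  move=> eT x y xe ye /= /(colE _ (fE _ eT)) h; apply: finj; apply: h; exact: imset_f.
have hk : k < 2 * k - 1 by lia.
pose z : 'I_(2 * k - 1) := Ordinal hk.
have e1 : tent_edge1 k \in hg_edges (tent k i) by rewrite !inE eqxx.
have e2 : tent_edge2 k i \in hg_edges (tent k i) by rewrite !inE eqxx orbT.
have e3 : tent_edge3 k i \in hg_edges (tent k i) by rewrite !inE eqxx orbT.
have /eqP full : (col \o f) @: tent_edge1 k == [set: 'I_k].
  rewrite eqEcard finset.subsetT cardsT card_ord card_in_imset; last exact: inj.
  by rewrite (tent_uniform ik e1) leqnn.
have : (col \o f) z \in (col \o f) @: tent_edge1 k by rewrite full inE.
move=> /imsetP[x x1 zx].
have z2 : z \in tent_edge2 k i by rewrite inE /=; lia.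
have z3 : z \in tent_edge3 k i by rewrite inE /=; lia.
have xk : x < k by move: x1; rewrite inE /=; lia.
suff : z = x by move=> /(congr1 val) /= kx; rewrite -kx ltnn in xk.
case: (ltnP x i) => xi.
  by apply: (inj _ e2) => //; rewrite inE /= xi.
apply: (inj _ e3) => //; rewrite inE /=.
by apply/orP; left; move: xi xk; clear; case: x => /= x _; lia.
Qed.

(** Vertices are coloured by their residues modulo [k]; the edge of [g] takes from class [c] the
    vertex with quotient [g c]. *)
Lemma partite_edges_card (n k : nat) : 0 < k ->
  exists E : {set {set 'I_n}}, [/\ forall e, e \in E -> #|e| = k,
    exists col : 'I_n -> 'I_k, forall e, e \in E -> {in e &, injective col} &
    (n %/ k) ^ k <= #|E|].
Proof.
move=> k0; pose q := n %/ k.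
have lt (a : 'I_q) (c : 'I_k) : a * k + c < n.
  apply: leq_trans (leq_divM n k); apply: (@leq_trans (a.+1 * k)).
    by rewrite mulSn addnC ltn_add2r.
  by rewrite leq_mul2r ltn_ord orbT.
pose vtx (g : {ffun 'I_k -> 'I_q}) (c : 'I_k) : 'I_n := Ordinal (lt (g c) c).
pose col (x : 'I_n) : 'I_k := Ordinal (ltn_pmod x k0).
have colK g : cancel (vtx g) col.
  by move=> c; apply: val_inj => /=; rewrite modnMDl modn_small.
pose edge g : {set 'I_n} := vtx g @: [set: 'I_k].
exists (edge @: [set: {ffun 'I_k -> 'I_q}]); split.
- move=> _ /imsetP[g _ ->]; rewrite card_imset ?cardsT ?card_ord //; exact: can_inj (colK g).
- exists col => _ /imsetP[g _ ->] _ _ /imsetP[c _ ->] /imsetP[d _ ->].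
  by rewrite !colK => ->.
- rewrite card_imset ?cardsT ?card_ffun ?card_ord // => g h gh; apply/ffunP => c.
  have : vtx g c \in edge h by rewrite -gh imset_f.
  move=> /imsetP[d _ e]; have := congr1 col e; rewrite !colK => cd.
  move: e; rewrite -cd => /(congr1 val) /= /addIn /eqP.
  by rewrite eqn_pmul2r // => /eqP /val_inj.
Qed.

Lemma turan_number_tents_ge (n k t : nat) : t < k ->
  (n %/ k) ^ k <= turan_number k n (tents_up_to k t).
Proof.
move=> tk; have [|E [uE [col colE] cE]] := @partite_edges_card n k; first by lia.
apply: leq_trans cE _; apply: (@leq_bigmax_cond _ _ (fun E : {set {set 'I_n}} => #|E|)).
apply/asboolP; split; first exact: uE.
move=> _ [i /= it <-]; apply: partite_tent_free colE _; lia.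
Qed.

Lemma turan_number_tents_le (R : realType) (n k t : nat) : 0 < t < k ->
  (\sum_(t.+1 <= j < k.+1) (j%:R)^-1 <= 1 :> R)%R ->
  turan_number k n (tents_up_to k t) * k ^ k <= n ^ k + k.+1 * 'C(n, k.-1) * k ^ k.
Proof.
move=> tk ht; rewrite /turan_number.
apply: (big_ind (fun m => m * k ^ k <= _)) => // [x y hx hy|E /asboolP[uE fE]].
  by rewrite /maxn; case: ifP.
have [E' [EE cE dE]] := min_codegree_subgraph k k.+1 E.
have uE' e : e \in E' -> #|e| = k by move=> eE; apply: uE; apply: (fintype.subsetP EE).
have fE' : family_free (tents_up_to k t) (Hypergraph E').
  move=> H FH [f [finj hf]]; apply: (fE H FH); exists f; split=> // e eH.
  exact: (fintype.subsetP EE) (hf e eH).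
have nt : no_tent_image t E'.
  by apply: (min_codegree_no_tent_image _ uE' dE fE'); case/andP: tk.
have := card_edges_le uE' nt tk ht; rewrite card_ord => h.
rewrite card_ord in cE.
apply: leq_trans (leq_mul cE (leqnn _)) _.
by rewrite mulnDl leq_add2r.
Qed.

(** * The threshold and the limit *)

Lemma sum_inv_gt_threshold (R : realType) (k : nat) : 2 <= k ->
  (\sum_((tent_threshold k).+1 <= j < k.+1) (j%:R)^-1 <= 1 :> R)%R.
Proof.
move=> k2; have [_ _ h] := tent_thresholdP k2.
(* Maximality of the threshold at its successor; the bound is then carried from the rationals to
   [R]. *)
have : ~~ (1 < harmonic_tail (tent_threshold k).+1 k)%R.
  by apply/negP => /(h _ (ltn0Sn _)); rewrite ltnn.
rewrite -leNgt -(ler_rat R) rmorph1 /harmonic_tail rmorph_sum /=.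
by under eq_bigr do rewrite fmorphV /= ratr_nat.
Qed.

Lemma ffact_le_exp n k : n ^_ k <= n ^ k.
Proof.
elim: k n => // k IH [|n]; first by rewrite ffact0n.
rewrite ffactSS expnS leq_mul2l; apply: leq_trans (IH n) _.
by case: k {IH} => // k; rewrite leq_exp2r.
Qed.

Lemma exp_le_ffact m k : m.+1 ^ k <= (m + k) ^_ k.
Proof.
elim: k => // k IH; rewrite addnS ffactSS expnS leq_mul // ltnS; exact: leq_addr.
Qed.

(** With [n = m + k], the factor [1 + (k - 1) * harmonic m] is [n / (m + 1)], and [n ^_ k] lies
    between [(m + 1) ^ k] and [n ^ k]. The shift by [k] keeps ['C(n, k)] positive. *)
Lemma turan_ratio_bounds (R : realType) (k t m : nat) : (0 < t < k)%N ->
  (\sum_(t.+1 <= j < k.+1) (j%:R)^-1 <= 1 :> R)%R ->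
  (k`!%:R / k%:R ^+ k * (1 + k.-1%:R * harmonic m)^-1 ^+ k <=
    turan_ratio R k (tents_up_to k t) (m + k) <=
    k`!%:R / k%:R ^+ k * (1 + k.-1%:R * harmonic m) ^+ k +
      (k.+1 * k)%:R * harmonic m)%R.
Proof.
move=> tk ht; rewrite /turan_ratio.
set b := (1 + _)%R; set L := (k`!%:R / _)%R.
have k0 : 0 < k by case/andP: tk => _; apply: leq_trans.
have lo := @turan_number_tents_ge (m + k) k t _.
have {}lo := lo ltac:(by case/andP: tk).
have up := turan_number_tents_le (m + k) tk ht.
set u := turan_number _ _ _ in lo up *.
(* Rounding [m + k] down to a multiple of [k] loses at most [k - 1]. *)
have lo' : m.+1 ^ k <= u * k ^ k.
  apply: leq_trans (leq_mul lo (leqnn _)); rewrite -expnMn leq_exp2r //.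
  by rewrite {1}(divn_eq (m + k) k); have := ltn_pmod (m + k) k0; have := divn_eq (m + k) k; lia.
(* This identity turns the cost of the deleted edges into the [harmonic m] error term. *)
have cb : k * 'C(m + k, k) = m.+1 * 'C(m + k, k.-1).
  have := mul_bin_left (m + k) k.-1; rewrite prednK // => ->.
  by congr (_ * _); lia.
have cf : 'C(m + k, k) * k`! = (m + k) ^_ k by rewrite bin_ffact.
have fl := exp_le_ffact m k; rewrite -cf in fl.
have fu := ffact_le_exp (m + k) k; rewrite -cf in fu.
have C0 : (0 < 'C(m + k, k)%:R :> R)%R by rewrite ltr0n bin_gt0 leq_addl.
have k0R : (0 < k%:R :> R)%R by rewrite ltr0n.
have m0R : (0 < m.+1%:R :> R)%R by rewrite ltr0n.
have n0R : (0 < (m + k)%:R :> R)%R by rewrite ltr0n addn_gt0 k0 orbT.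
have f0R : (0 < k`!%:R :> R)%R by rewrite ltr0n fact_gt0.
have bE : b = ((m + k)%:R / m.+1%:R)%R.
  rewrite /b /harmonic /=; apply: (mulIf (lt0r_neq0 m0R)).
  rewrite divfK ?lt0r_neq0 // mulrDl divfK ?lt0r_neq0 // mul1r -natrD; congr (_%:R)%R; lia.
apply/andP; split.
  rewrite ler_pdivlMr // bE invf_div expr_div_n /L.
  have -> : (k`!%:R / k%:R ^+ k * (m.+1%:R ^+ k / (m + k)%:R ^+ k) * 'C(m + k, k)%:R =
    (m.+1%:R ^+ k * ('C(m + k, k) * k`!)%:R) / (k%:R ^+ k * (m + k)%:R ^+ k) :> R)%R.
    by rewrite invfM natrM; ring.
  rewrite ler_pdivrMr ?mulr_gt0 ?exprn_gt0 // mulrA -!natrX -!natrM ler_nat.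
  exact: leq_mul.
rewrite ler_pdivrMr // -(@ler_pM2r _ (k%:R ^+ k)%R) ?exprn_gt0 //.
rewrite -natrX -natrM; apply: le_trans (_ : (_%:R <= _)%R); first by rewrite ler_nat; exact: up.
rewrite natrD !mulrDl; apply: lerD.
  rewrite bE expr_div_n /L.
  have -> : (k`!%:R / k%:R ^+ k * ((m + k)%:R ^+ k / m.+1%:R ^+ k) * 'C(m + k, k)%:R * (k ^ k)%:R =
    (m + k)%:R ^+ k * ('C(m + k, k) * k`!)%:R / m.+1%:R ^+ k :> R)%R.
    rewrite natrX natrM; move: (k%:R ^+ k)%R (exprn_gt0 k k0R) (m.+1%:R ^+ k)%R (exprn_gt0 k m0R).
    by move=> x x0 y y0; field; rewrite !lt0r_neq0.
  rewrite ler_pdivlMr ?exprn_gt0 // -!natrX -!natrM ler_nat; exact: leq_mul.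
rewrite natrM ler_wpM2r ?ler0n // /harmonic /= [leRHS]mulrAC ler_pdivlMr //.
by rewrite -!natrM ler_nat -!mulnA cb [_ * m.+1]mulnC.
Qed.

Section Limit.
Local Open Scope ring_scope.
Local Open Scope classical_set_scope.

Lemma turan_ratio_cvg (R : realType) (k t : nat) : (0 < t < k)%N ->
  \sum_(t.+1 <= j < k.+1) (j%:R)^-1 <= 1 :> R ->
  turan_ratio R k (tents_up_to k t) @ \oo --> (k`!%:R / k%:R ^+ k : R).
Proof.
move=> tk ht; rewrite -(cvg_shiftn k).
set L : R := k`!%:R / k%:R ^+ k.
pose b (m : nat) : R := 1 + k.-1%:R * harmonic m.
have hc (c : R) : (fun m => c * harmonic m) @ \oo --> (0 : R).
  rewrite -[X in _ --> X](mulr0 c).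
  by apply: cvgMr; exact: cvg_harmonic.
have hb : b @ \oo --> (1 : R).
  rewrite -[X in _ --> X]addr0.
  by apply: cvgD; [exact: cvg_cst | exact: hc].
have hX (c : nat -> R) : c @ \oo --> (1 : R) -> (fun m => L * c m ^+ k) @ \oo --> L.
  move=> h; suff : (fun m => L * c m ^+ k) @ \oo --> L * 1 ^+ k by rewrite expr1n mulr1.
  apply: cvgMr; apply: (@continuous_cvg _ _ _ _ _ c (fun x : R => x ^+ k) 1 _ h).
  exact: exprn_continuous.
apply: (squeeze_cvgr (f := fun m => L * (b m)^-1 ^+ k)
  (h := fun m => L * b m ^+ k + (k.+1 * k)%:R * harmonic m)).
- by apply: nearW => m; apply: turan_ratio_bounds.
- by apply: hX; rewrite -[X in _ --> X]invr1; apply: cvgV => //; exact: oner_neq0.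
- by rewrite -[X in _ --> X]addr0; apply: cvgD; [exact: hX | exact: hc].
Qed.
End Limit.

(** Convergence is asserted as well, since [limn] of a divergent sequence would be a mere default
    value. *)
Theorem theorem1p1 (R : realType) (k : nat) (hk : (2 <= k)%N) :
  cvgn (turan_ratio R k (tents_up_to k (tent_threshold k))) /\
  turan_density R k (tents_up_to k (tent_threshold k)) =
    (k`!%:R / k%:R ^+ k)%R.
Proof.
have [tk _ _] := tent_thresholdP hk.
have h := turan_ratio_cvg tk (sum_inv_gt_threshold R hk).
split; first by apply/cvg_ex; eexists; exact: h.
by apply/cvg_lim; first exact: norm_hausdorff.
Qed.
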